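(* Let $\beta\ge 0$, $h\in\mathbb{R}$, $n\ge 1$, and suppose $\sigma=(\sigma_1,\ldots,\sigma_n)$ is drawn from the Curie-Weiss Gibbs measure on $\{-1,1\}^n$ with inverse temperature $\beta$ and external field $h$, i.e. $$\mathbb{P}(\{\sigma\})=Z^{-1}\exp\left(\frac{\beta}{n}\sum_{1\le i<j\le n}\sigma_i\sigma_j+\beta h\sum_{i=1}^n\sigma_i\right).$$ Then for every $t\ge 0$, the magnetization $m:=\frac1n\sum_{i=1}^n\sigma_i$ satisfies $$\mathbb{P}\left\{\left|m-\tanh(\beta m+\beta h)\right|\ge\frac{\beta}{n}+\frac{t}{\sqrt n}\right\}\le 2\exp\left(-\frac{t^2}{4(1+\beta)}\right).$$
   Context: $Z=Z(n,\beta,h)$ is the normalizing constant making the displayed weights a probability mass function on $\{-1,1\}^n$. *)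

(* Defs.v *)
From HB Require Import structures.
From mathcomp Require Import all_boot all_order all_algebra.
From mathcomp Require Import all_classical all_reals all_analysis.

Set Implicit Arguments.
Unset Strict Implicit.
Unset Printing Implicit Defensive.

Import Order.TTheory GRing.Theory Num.Theory.

Local Open Scope classical_set_scope.
Local Open Scope ring_scope.

Definition tanh {R : realType} (x : R) : R :=
  (expR x - expR (- x)) / (expR x + expR (- x)).

(* The hypercube {-1, 1}^n is encoded by boolean vectors, [true] standing for
   the spin +1 and [false] for the spin -1, with the discrete sigma-algebra. *)
Definition config (n : nat) : Type := {ffun 'I_n -> bool}.

HB.instance Definition _ n := Finite.on (config n).
HB.instance Definition _ n := isPointed.Build (config n) [ffun=> true].
HB.instance Definition _ n := @isMeasurable.Build default_measure_display
  (config n) discrete_measurable discrete_measurable0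
  discrete_measurableC discrete_measurableU.

Definition spin {R : realType} {n : nat} (s : config n) (i : 'I_n) : R :=
  if s i then 1 else -1.

Definition magnetization {R : realType} {n : nat} (s : config n) : R :=
  n%:R^-1 * \sum_(i < n) spin s i.

Section curie_weiss.
Context {R : realType} (n : nat) (beta h : R).

Definition cw_weight (s : config n) : R :=
  expR (beta / n%:R * (\sum_(i < n) \sum_(j < n | (i < j)%N) spin s i * spin s j)
        + beta * h * \sum_(i < n) spin s i).

Definition cw_Z : R := \sum_(s : config n) cw_weight s.

Definition cw_pmf (s : config n) : R := cw_Z^-1 * cw_weight s.

Definition curie_weiss (A : set (config n)) : \bar R :=
  (\sum_(s \in A) (cw_pmf s)%:E)%E.

Lemma cw_Z_gt0 : 0 < cw_Z.
Proof.
rewrite /cw_Z (bigD1 (point : config n))//= ltr_pwDl ?expR_gt0//.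
by apply: sumr_ge0 => s _; exact: expR_ge0.
Qed.

Lemma cw_pmf_ge0 s : 0 <= cw_pmf s.
Proof. by rewrite mulr_ge0 ?expR_ge0// invr_ge0 ltW// cw_Z_gt0. Qed.

Lemma cw_pmf1 : \sum_(s : config n) cw_pmf s = 1.
Proof. by rewrite -mulr_sumr mulVf// gt_eqF// cw_Z_gt0. Qed.

Let curie_weiss0 : curie_weiss set0 = 0%E.
Proof. by rewrite /curie_weiss fsbig_set0. Qed.

Let curie_weiss_ge0 A : (0 <= curie_weiss A)%E.
Proof.
rewrite /curie_weiss fsbig_finite//= sumEFin lee_fin.
by apply: sumr_ge0 => s _; exact: cw_pmf_ge0.
Qed.

Let curie_weiss_sigma_additive : semi_sigma_additive curie_weiss.
Proof.
move=> F mF tF mUF; rewrite /curie_weiss; apply: cvg_toP.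
  apply: ereal_nondecreasing_is_cvgn => k m km.
  by apply: lee_sum_nneg_natr => // i _ _; exact: curie_weiss_ge0.
transitivity (\sum_(0 <= i <oo) (\esum_(s in F i) (cw_pmf s)%:E))%E.
  apply: eq_eseriesr => k _; rewrite esum_fset//= => s _.
  by rewrite lee_fin cw_pmf_ge0.
rewrite -nneseries_sum_bigcup//=; last first.
  by move=> s; rewrite lee_fin cw_pmf_ge0.
by rewrite esum_fset//= => s _; rewrite lee_fin cw_pmf_ge0.
Qed.

HB.instance Definition _ := isMeasure.Build _ _ _ curie_weiss
  curie_weiss0 curie_weiss_ge0 curie_weiss_sigma_additive.

Let curie_weiss_setT : curie_weiss [set: _] = 1%E.
Proof.
rewrite /curie_weiss fsbig_finite//= sumEFin -[1%E]/(1%:E) -cw_pmf1.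
congr EFin; apply: perm_big; apply: uniq_perm.
- exact: finmap.fset_uniq.
- exact: index_enum_uniq.
- move=> s; rewrite in_fset_set; last exact: finite_finset.
  by rewrite mem_set//; exact/esym/mem_index_enum.
Qed.

HB.instance Definition _ :=
  @Measure_isProbability.Build _ _ R curie_weiss curie_weiss_setT.

Lemma curie_weiss1 s : curie_weiss [set s] = (cw_pmf s)%:E.
Proof. by rewrite /curie_weiss fsbig_set1. Qed.

End curie_weiss.
Arguments curie_weiss {R} n beta h A.

(* Main.v *)
(** Chatterjee's method of exchangeable pairs.  Resampling a uniformly chosen
    spin from its conditional law given the others yields an exchangeable pair
    (s, s').  With F(s, s') = sum_i (s_i - s'_i), which is antisymmetric,
      f(s) = E[F(s, s') | s] = (1/n) sum_i (s_i - tanh (beta m_i + beta h)),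
    where m_i is the magnetization without its i-th term.  Exchangeability gives
      E[f e^(theta f)] = E[F(s, s') (e^(theta f(s)) - e^(theta f(s')))] / 2.
    As |F| <= 2 and |f(s) - f(s')| <= 2 (1 + beta) / n, the moment generating
    function M of f satisfies M' <= C theta M with C = 2 (1 + beta) / n, whence
    M(theta) <= exp (C theta^2 / 2) and a sub-Gaussian tail for f.  As tanh is
    1-Lipschitz and |m - m_i| = 1/n, f differs from m - tanh (beta m + beta h)
    by at most beta / n. *)
Require Import Defs.
From mathcomp Require Import all_boot all_order all_algebra.
From mathcomp Require Import all_classical all_reals all_analysis.
From mathcomp Require Import ring lra.
Import Order.TTheory GRing.Theory Num.Theory numFieldNormedType.Exports.
Local Open Scope classical_set_scope.
Local Open Scope ring_scope.

Set Implicit Arguments.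
Unset Strict Implicit.

(** * Elementary inequalities for exp and tanh *)

Lemma expR_sub1_le (R : realType) (x : R) (x_ge0 : 0 <= x) :
  expR x - 1 <= x * (expR x + 1) / 2.
Proof.
(* The trapezoidal rule overestimates the integral of the convex function [expR] over [[0, x]]; the
   gap [g] is nondecreasing because [1 - y <= expR (- y)]. *)
pose g (y : R) := y * (expR y + 1) / 2 - expR y.
pose dg (y : R) := ((y - 1) * expR y + 1) / 2.
have dgE (y : R) : is_derive y 1 g (dg y).
  by apply: is_derive_eq; rewrite /dg !scaler1 /GRing.scale/=; field.
have dg_ge0 (y : R) : 0 <= dg y.
  have := expR_ge1Dx (- y); rewrite expRN -(ler_pM2r (expR_gt0 y)).
  by rewrite mulVf ?gt_eqF ?expR_gt0// /dg; lra.
suff : g 0 <= g x by rewrite /g expR0; lra.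
apply: (@ger0_derive1_ndecry _ g 0) => //.
- by move=> y _; rewrite derive1E (@derive_val _ _ _ _ _ _ _ (dgE y)).
- apply/continuous_subspaceT => y.
  by apply/differentiable_continuous/derivable1_diffP; case: (dgE y).
Qed.

(** The trapezoidal bound on [[0, x - y]], scaled by [expR y]. Averaging the two endpoint values
    keeps the bound symmetric in [x] and [y], as symmetrization over the exchangeable pair
    requires. *)
Lemma expR_dist_le (R : realType) (x y : R) :
  `|expR x - expR y| <= `|x - y| * ((expR x + expR y) / 2).
Proof.
wlog yx : x y / y <= x.
  move=> H; have [/H//|/ltW/H] := leP y x.
  by rewrite distrC [in `|y - x|]distrC [expR y + _]addrC.
have := @expR_sub1_le R (x - y); rewrite subr_ge0 => /(_ yx).
rewrite !ger0_norm ?subr_ge0 ?ler_expR//.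
rewrite -(ler_pM2r (expR_gt0 y)) => /le_trans H.
have E : expR x = expR (x - y) * expR y by rewrite -expRD subrK.
by rewrite E; have := H _ (lexx _); lra.
Qed.

(** With [a = expR x] and [b = expR y], the difference is [2 (a - b) (a + b) / ((a^2 + 1) (b^2 +
    1))]. The trapezoidal bound controls [2 (a - b)] by [(x - y) (a + b)], and
    [(a + b)^2 <= (a^2 + 1) (b^2 + 1)] amounts to [0 <= (a b - 1)^2]. *)
Lemma tanh_sub_le (R : realType) (x y : R) (yx : y <= x) :
  0 <= tanh x - tanh y <= x - y.
Proof.
have := @expR_sub1_le R (x - y); rewrite subr_ge0 => /(_ yx).
have : 1 <= expR (x - y) by rewrite -expR0 ler_expR subr_ge0.
rewrite /tanh !expRN expRD expRN.
have := expR_gt0 x; have := expR_gt0 y.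
set a := expR x; set b := expR y => b0 a0 H1 H2.
have ba : b <= a by move: H1; rewrite ler_pdivlMr // mul1r.
have {}H2 : 2 * (a - b) <= (x - y) * (a + b).
  move: H2; rewrite -(ler_pM2r b0) [_ * b](_ : _ = a - b);
    last by field; rewrite gt_eqF.
  rewrite [leRHS](_ : _ = (x - y) * (a + b) / 2); last by field; rewrite gt_eqF.
  by lra.
have a2 : 0 < a ^+ 2 + 1 by rewrite ltr_wpDl // sqr_ge0.
have b2 : 0 < b ^+ 2 + 1 by rewrite ltr_wpDl // sqr_ge0.
have -> : (a - a^-1) / (a + a^-1) - (b - b^-1) / (b + b^-1) =
  2 * (a - b) * (a + b) / ((a ^+ 2 + 1) * (b ^+ 2 + 1)).
  by field; rewrite !gt_eqF// ?addr_gt0 ?invr_gt0 //.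
apply/andP; split.
  apply: divr_ge0; last by rewrite ltW// mulr_gt0.
  by rewrite mulr_ge0 ?mulr_ge0 ?subr_ge0// ltW ?addr_gt0.
rewrite ler_pdivrMr ?mulr_gt0//.
apply: (@le_trans _ _ ((x - y) * (a + b) * (a + b))).
  by rewrite ler_wpM2r // addr_ge0 // ltW.
rewrite -mulrA ler_wpM2l ?subr_ge0//.
rewrite -subr_ge0 [leRHS](_ : _ = (a * b - 1) ^+ 2) ?sqr_ge0//; ring.
Qed.

Lemma tanh_lipschitz (R : realType) (x y : R) : `|tanh x - tanh y| <= `|x - y|.
Proof.
wlog yx : x y / y <= x.
  by move=> H; have [/H//|/ltW/H] := leP y x; rewrite distrC [leRHS]distrC.
by have /andP[t0 t1] := tanh_sub_le yx; rewrite !ger0_norm// subr_ge0.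
Qed.

(** * Sub-Gaussian tails from a reversible chain *)

Lemma is_derive_ler0_nincr (R : realType) (f df : R -> R) (a b : R) :
  (forall x : R, is_derive x 1 f (df x)) ->
  (forall x, a <= x -> df x <= 0) ->
  a <= b -> f b <= f a.
Proof.
move=> fE df_le0 ab; apply: (@ler0_derive1_nincry _ f a) => //.
- move=> x; rewrite in_itv/= andbT => ax.
  by rewrite derive1E (@derive_val _ _ _ _ _ _ _ (fE x)) df_le0// ltW.
- apply/continuous_subspaceT => x.
  by apply/differentiable_continuous/derivable1_diffP; case: (fE x).
Qed.

(* The reversible chain moves from [s] to [phi i s] at rate [q i s / p s], so
   [q_sym] is detailed balance; the transitions that stay put are left out, as
   they do not contribute to [fE] and [vC]. *)
Section exchangeable.
Context {R : realType} {S : finType} {I : finType}.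
Variables (p f : S -> R) (phi : I -> S -> S) (q F : I -> S -> R) (C : R).
Hypothesis p1 : \sum_s p s = 1.
Hypothesis phiK : forall i, involutive (phi i).
Hypothesis q_ge0 : forall i s, 0 <= q i s.
Hypothesis q_sym : forall i s, q i (phi i s) = q i s.
Hypothesis F_anti : forall i s, F i (phi i s) = - F i s.
Hypothesis fE : forall s, p s * f s = \sum_i q i s * F i s.
Hypothesis vC : forall s,
  \sum_i q i s * (`|f s - f (phi i s)| * `|F i s|) <= 2 * C * p s.

Let M (theta : R) := \sum_s p s * expR (theta * f s).

(** The left side is the derivative of [M]. Detailed balance and antisymmetry of [F] turn twice this
    sum into one over differences of exponentials; after [expR_dist_le], the same symmetry folds the
    average back onto [s], where [vC] applies. *)
Lemma mgf_deriv_le (theta : R) (theta_ge0 : 0 <= theta) :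
  \sum_s p s * f s * expR (theta * f s) <= C * theta * M theta.
Proof.
pose E s := expR (theta * f s).
have sym (G : I -> S -> R) : \sum_s \sum_i G i (phi i s) = \sum_s \sum_i G i s.
  rewrite exchange_big [RHS]exchange_big; apply: eq_bigr => i _.
  by rewrite [RHS](reindex_inj (inv_inj (phiK i))).
have -> : \sum_s p s * f s * E s = \sum_s \sum_i q i s * F i s * E s.
  by apply: eq_bigr => s _; rewrite fE mulr_suml.
pose A i s := q i s * F i s * E s.
pose B i s := q i s * (`|f s - f (phi i s)| * `|F i s|) * E s.
have AB : \sum_s \sum_i (A i s + A i (phi i s)) <=
    theta / 2 * \sum_s \sum_i (B i s + B i (phi i s)).
  rewrite mulr_sumr; apply: ler_sum => s _.
  rewrite mulr_sumr; apply: ler_sum => i _.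
  rewrite /A /B q_sym F_anti phiK normrN [`|f (phi i s) - _|]distrC.
  have -> : q i s * F i s * E s + q i s * - F i s * E (phi i s) =
            q i s * (F i s * (E s - E (phi i s))) by ring.
  have -> : theta / 2 * (q i s * (`|f s - f (phi i s)| * `|F i s|) * E s +
      q i s * (`|f s - f (phi i s)| * `|F i s|) * E (phi i s)) =
      q i s * (`|F i s| * (theta * `|f s - f (phi i s)| *
        ((E s + E (phi i s)) / 2))) by field.
  apply: ler_wpM2l => //; apply: (le_trans (ler_norm _)); rewrite normrM.
  apply: ler_wpM2l => //; apply: (le_trans (expR_dist_le _ _)).
  by rewrite -mulrBr normrM (ger0_norm theta_ge0).
have BC : \sum_s \sum_i B i s <= 2 * C * M theta.
  rewrite mulr_sumr; apply: ler_sum => s _; rewrite -mulr_suml mulrA.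
  by apply: ler_wpM2r; rewrite ?expR_ge0.
move: AB; under eq_bigr do rewrite big_split/=; rewrite big_split/= sym.
under [in leRHS]eq_bigr do rewrite big_split/=; rewrite big_split/= sym.
have := ler_wpM2l theta_ge0 BC; rewrite /A; lra.
Qed.

(** Gronwall's argument: [M x * expR (- (C * x ^+ 2 / 2))] equals 1 at 0 and is nonincreasing for
    [x >= 0] by [mgf_deriv_le]. *)
Lemma mgf_le (theta : R) (theta_ge0 : 0 <= theta) :
  M theta <= expR (C * theta ^+ 2 / 2).
Proof.
pose g s (x : R) := p s * expR (x * f s - C * x ^+ 2 / 2).
pose dg s (x : R) := p s * (f s - C * x) * expR (x * f s - C * x ^+ 2 / 2).
have gE s (x : R) : is_derive x 1 (g s) (dg s x).
  pose e (y : R) := y * f s - C * y ^+ 2 / 2.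
  have eE : is_derive x 1 e (f s - C * x).
    by apply: is_derive_eq; rewrite /GRing.scale/=; field.
  have -> : g s = p s \*: (expR \o e) by [].
  by apply: is_derive_eq; rewrite /dg /GRing.scale/= /e; ring.
have GE (x : R) : is_derive x 1 (\sum_s g s) (\sum_s dg s x).
  by elim/big_ind2 : _ => // [|? ? ? ? ? ?];
    [exact: is_derive_cst|exact: is_deriveD].
have E (x : R) : M x = (\sum_s g s) x * expR (C * x ^+ 2 / 2).
  rewrite fct_sumE mulr_suml; apply: eq_bigr => s _.
  by rewrite /g -mulrA -expRD subrK.
rewrite E -[leRHS]mul1r ler_wpM2r ?expR_ge0//.
apply: (@le_trans _ _ ((\sum_s g s) 0)); last first.
  rewrite fct_sumE -p1; apply: ler_sum => s _.
  by rewrite /g expr0n mul0r mulr0 mul0r subrr expR0 mulr1.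
apply: is_derive_ler0_nincr GE _ theta_ge0 => x x_ge0.
rewrite -(ler_pM2r (expR_gt0 (C * x ^+ 2 / 2))) mul0r.
suff -> : (\sum_s dg s x) * expR (C * x ^+ 2 / 2) =
    \sum_s p s * f s * expR (x * f s) - C * x * M x.
  by rewrite subr_le0 mgf_deriv_le.
rewrite mulr_suml /M mulr_sumr -sumrB; apply: eq_bigr => s _.
by rewrite /dg -mulrA -expRD subrK; ring.
Qed.

End exchangeable.

Lemma exchangeable_concentration (R : realType) (S I : finType)
    (p f : S -> R) (phi : I -> S -> S) (q F : I -> S -> R) (C u : R)
    (D : pred S) :
  (forall s, 0 <= p s) -> \sum_s p s = 1 ->
  (forall i, involutive (phi i)) ->
  (forall i s, 0 <= q i s) -> (forall i s, q i (phi i s) = q i s) ->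
  (forall i s, F i (phi i s) = - F i s) ->
  (forall s, p s * f s = \sum_i q i s * F i s) ->
  (forall s,
    \sum_i q i s * (`|f s - f (phi i s)| * `|F i s|) <= 2 * C * p s) ->
  0 < C -> 0 <= u -> (forall s, D s -> u <= `|f s|) ->
  \sum_(s | D s) p s <= 2 * expR (- (u ^+ 2 / (2 * C))).
Proof.
move=> p_ge0 p1 phiK q_ge0 q_sym F_anti fE vC C_gt0 u_ge0 Du.
(* The minimizer of the Chernoff exponent [C * theta ^+ 2 / 2 - theta * u]. *)
pose theta := u / C.
have theta_ge0 : 0 <= theta by rewrite divr_ge0// ltW.
have M1 := mgf_le p1 phiK q_ge0 q_sym F_anti fE vC theta_ge0.
(* The lower tail: negating both [f] and [F] preserves all the hypotheses. *)
have M2 : \sum_s p s * expR (theta * (- f s)) <= expR (C * theta ^+ 2 / 2).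
  apply: (mgf_le (phi := phi) (q := q) (F := fun i s => - F i s)) => //.
  - by move=> i s; rewrite F_anti.
  - by move=> s; rewrite mulrN fE -sumrN; apply: eq_bigr => i _; rewrite mulrN.
  - move=> s; apply: le_trans (vC s); apply: ler_sum => i _.
    by rewrite opprK addrC distrC normrN.
have -> : - (u ^+ 2 / (2 * C)) = C * theta ^+ 2 / 2 - theta * u.
  by rewrite /theta; field; rewrite gt_eqF.
rewrite expRD; set e := expR (- (theta * u)).
apply: (@le_trans _ _
    (\sum_s (p s * expR (theta * f s) + p s * expR (theta * - f s)) * e)).
  rewrite big_mkcond/=; apply: ler_sum => s _; rewrite -mulrDr.
  case: ifP => [/Du us|_]; last first.
    by rewrite !mulr_ge0 ?addr_ge0 ?expR_ge0.
  rewrite -mulrA -[leLHS]mulr1 ler_wpM2l// mulrDl /e -!expRD.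
  have H (x y : R) : 0 <= x -> 1 <= expR x + expR y.
    move=> x0; apply: (@le_trans _ _ (expR x)); last by rewrite lerDl expR_ge0.
    by rewrite -expR0 ler_expR.
  move: us; rewrite ler_normr => /orP[us|us];
    [|rewrite addrC]; by apply: H; rewrite -mulrBr mulr_ge0// subr_ge0.
rewrite -mulr_suml big_split/= mulrA ler_wpM2r ?expR_ge0//.
by have := lerD M1 M2; lra.
Qed.

(** * Glauber dynamics for the Curie-Weiss measure *)

Lemma sum_lt_pairs (R : realFieldType) (n : nat) (x : 'I_n -> R) :
  \sum_(i < n) \sum_(j < n | (i < j)%N) x i * x j =
  ((\sum_(i < n) x i) ^+ 2 - \sum_(i < n) x i ^+ 2) / 2.
Proof.
set U := LHS; set Q := \sum_(i < n) x i ^+ 2.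
suff -> : (\sum_(i < n) x i) ^+ 2 = U + U + Q by field.
(* Exchanging the sums in one copy of [U] makes it run over [j < i], so that each row of the square
   splits into [i < j], [j < i] and the diagonal. *)
rewrite expr2 mulr_suml {2}/U (exchange_big_dep predT)//= /U /Q -!big_split/=.
apply: eq_bigr => i _; rewrite mulr_sumr.
rewrite (bigID (fun j : 'I_n => (i < j)%N))/= -addrA.
congr +%R; rewrite (bigD1 i) ?ltnn//= addrC; congr +%R.
apply: eq_big => [j|j _]; last by rewrite mulrC.
by rewrite -leqNgt [RHS]ltn_neqAle andbC.
Qed.

Section glauber.
Context {R : realType} (n : nat) (beta h : R).
Hypothesis beta_ge0 : 0 <= beta.
Hypothesis n_gt0 : (0 < n)%N.
Implicit Types (s : config n) (i j : 'I_n).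

Definition flip i s : config n := [ffun j => if j == i then ~~ s j else s j].

Lemma flipK i : involutive (flip i).
Proof.
by move=> s; apply/ffunP => j; rewrite !ffunE; case: eqP; rewrite ?negbK.
Qed.

Lemma spin_flip i j s :
  spin (flip i s) j = (if j == i then - spin s j else spin s j) :> R.
Proof.
by rewrite /spin ffunE; case: eqP => // _; case: (s j); rewrite ?opprK.
Qed.

Lemma spin_sq s i : spin s i ^+ 2 = 1 :> R.
Proof. by rewrite /spin; case: (s i); rewrite ?sqrrN expr1n. Qed.

Lemma normr_spin s i : `|spin s i| = 1 :> R.
Proof. by rewrite /spin; case: (s i); rewrite ?normrN normr1. Qed.

Lemma sum_spin_flip i s :
  \sum_(j < n) spin (flip i s) j = \sum_(j < n) spin s j - 2 * spin s i :> R.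
Proof.
rewrite (bigD1 i)//= spin_flip eqxx (bigD1 i (P := predT))//=.
under eq_bigr => j ji do rewrite spin_flip (negPf ji).
by ring.
Qed.

(** The field felt by spin [i] from the other spins; [tanh] of it is the conditional mean of that
    spin. *)
Definition cavity_field s i : R :=
  beta * (magnetization s - spin s i / n%:R) + beta * h.

Definition glauber_drift s : R :=
  n%:R^-1 * \sum_(i < n) (spin s i - tanh (cavity_field s i)).

Let n_neq0 : n%:R != 0 :> R. Proof. by rewrite pnatr_eq0 -lt0n. Qed.
Let n_pos : 0 < n%:R :> R. Proof. by rewrite ltr0n. Qed.

Lemma cavity_field_flip s i j : cavity_field (flip i s) j =
  cavity_field s j - (if j == i then 0 else 2 * beta * spin s i / n%:R).
Proof.
rewrite /cavity_field /magnetization sum_spin_flip spin_flip.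
by case: eqP => [->|_]; field.
Qed.

(** The pair energy depends only on the total spin. Expanding the square of the new total leaves a
    term in [x ^+ 2 = 1], which is exactly the self-interaction removed in [cavity_field]. *)
Lemma cw_weight_flip s i : cw_weight beta h (flip i s) =
  cw_weight beta h s * expR (- (2 * spin s i * cavity_field s i)).
Proof.
rewrite /cw_weight -expRD; congr expR; rewrite !sum_lt_pairs.
do 2 under [\sum_(i < n) _ ^+ 2]eq_bigr do rewrite spin_sq.
rewrite sum_spin_flip /cavity_field /magnetization.
have := spin_sq s i; set x := spin s i; set m := \sum_(j < n) _ => x2.
have -> : 2 * x * (beta * (n%:R^-1 * m - x / n%:R) + beta * h) =
  2 * beta * (m * x / n%:R - x ^+ 2 / n%:R + h * x) by field.
by rewrite x2 sqrrB exprMn x2; field.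
Qed.

(** The right side is [F] times the conditional probability of a flip, so this is the identity [fE]
    one site at a time. *)
Lemma spin_sub_tanh s i : spin s i - tanh (cavity_field s i) =
  2 * spin s i * (cw_weight beta h (flip i s) /
    (cw_weight beta h s + cw_weight beta h (flip i s))).
Proof.
rewrite cw_weight_flip; set w := cw_weight _ _ s; set a := cavity_field s i.
have w0 : 0 < w by exact: expR_gt0.
have a0 := expR_gt0 a.
have a2 : 0 < expR a ^+ 2 + 1 by rewrite ltr_wpDl // sqr_ge0.
have a2' : 0 < 1 + expR a ^+ 2 by rewrite addrC.
have E : expR (2 * a) = expR a ^+ 2 by rewrite mulr_natl mulr2n expRD expr2.
rewrite /tanh /spin; case: (s i).
  by rewrite mulr1 !expRN E; field; rewrite !gt_eqF// ?addr_gt0 ?mulr_gt0.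
have -> : - (2 * -1 * a) = 2 * a by ring.
by rewrite expRN E; field; rewrite !gt_eqF// ?addr_gt0 ?mulr_gt0.
Qed.

Lemma glauber_drift_flip s i :
  `|glauber_drift s - glauber_drift (flip i s)| <= 2 * (1 + beta) / n%:R.
Proof.
rewrite /glauber_drift -mulrBr normrM gtr0_norm ?invr_gt0// [leRHS]mulrC.
rewrite ler_wpM2l ?invr_ge0 ?ler0n// !sumrB sum_spin_flip.
set a := \sum_(j < n) tanh (cavity_field s j).
set b := \sum_(j < n) tanh _; set m := \sum_(j < n) _.
have -> : m - a - (m - 2 * spin s i - b) = 2 * spin s i + (b - a) by ring.
have : `|b - a| <= 2 * beta.
  rewrite /a /b -sumrB (le_trans (ler_norm_sum _ _ _))//.
  have -> : 2 * beta = \sum_(j < n) (2 * beta / n%:R).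
    by rewrite sumr_const card_ord -[RHS]mulr_natr divfK.
  apply: ler_sum => j _; apply: (le_trans (tanh_lipschitz _ _)).
  rewrite cavity_field_flip addrAC subrr sub0r normrN.
  (* The cavity field at the flipped site does not see its own spin. *)
  case: eqP => _; first by rewrite normr0 divr_ge0 ?mulr_ge0.
  by rewrite !normrM normfV normr_spin !ger0_norm// mulr1.
have := ler_normD (2 * spin s i) (b - a).
by rewrite normrM normr_spin normr_nat; lra.
Qed.

Lemma magnetization_drift_dist s :
  `|magnetization s - tanh (beta * magnetization s + beta * h)|
    <= `|glauber_drift s| + beta / n%:R.
Proof.
rewrite -lerBlDl; apply: (le_trans (lerB_dist _ _)).
set c := tanh _.
have -> : magnetization s - c - glauber_drift s =
    n%:R^-1 * \sum_(i < n) (tanh (cavity_field s i) - c).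
  rewrite /glauber_drift /magnetization !sumrB sumr_const card_ord.
  by rewrite -mulr_natl; field.
rewrite normrM gtr0_norm ?invr_gt0// [leRHS]mulrC.
rewrite ler_wpM2l ?invr_ge0 ?ler0n// (le_trans (ler_norm_sum _ _ _))//.
have -> : beta = \sum_(j < n) (beta / n%:R).
  by rewrite sumr_const card_ord -[RHS]mulr_natr divfK.
apply: ler_sum => i _; apply: (le_trans (tanh_lipschitz _ _)).
have -> : cavity_field s i - (beta * magnetization s + beta * h) =
  - (beta * spin s i / n%:R) by rewrite /cavity_field; field.
by rewrite normrN !normrM normfV normr_spin !ger0_norm// mulr1.
Qed.

Lemma glauber_drift_tail (u : R) (D : pred (config n)) :
  0 <= u -> (forall s, D s -> u <= `|glauber_drift s|) ->
  \sum_(s | D s) cw_pmf beta h s <=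
    2 * expR (- (u ^+ 2 / (2 * (2 * (1 + beta) / n%:R)))).
Proof.
move=> u_ge0 Du; pose w := @cw_weight R n beta h.
have w_gt0 s : 0 < w s by exact: expR_gt0.
have Z_gt0 := cw_Z_gt0 n beta h.
have ww_gt0 s i : 0 < w s + w (flip i s) by rewrite addr_gt0.
(* The conditional law of spin [i] flips it with probability
   [w (flip i s) / (w s + w (flip i s))]. *)
pose q i s :=
  n%:R^-1 * (cw_pmf beta h s * (w (flip i s) / (w s + w (flip i s)))).
apply: (@exchangeable_concentration _ _ _ (cw_pmf beta h) glauber_drift flip q
  (fun i s => 2 * spin s i)) => //.
- exact: cw_pmf_ge0.
- exact: cw_pmf1.
- exact: flipK.
- by move=> i s; rewrite !mulr_ge0 ?invr_ge0 ?ler0n ?cw_pmf_ge0// ltW.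
(* Detailed balance: up to constants, [q i s] is [w s * w (flip i s)] over [w s + w (flip i s)]. *)
- move=> i s; rewrite /q flipK /cw_pmf -/w [w (flip i s) + _]addrC.
  by congr (_ * _); ring.
- by move=> i s; rewrite spin_flip eqxx mulrN.
- move=> s; rewrite /glauber_drift mulrCA !mulr_sumr; apply: eq_bigr => i _.
  by rewrite spin_sub_tanh /q -/w; ring.
- move=> s; set c := 2 * (1 + beta) / n%:R.
  (* Each of the [n] sites contributes at most [cw_pmf beta h s / n] from [q], [c] from the change
     of drift, and 2 from [F]. *)
  have -> : 2 * c * cw_pmf beta h s =
      \sum_(i < n) n%:R^-1 * cw_pmf beta h s * (c * 2).
    by rewrite sumr_const card_ord -[RHS]mulr_natr; field.
  apply: ler_sum => i _; rewrite normrM normr_spin normr_nat mulr1.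
  apply: ler_pM; rewrite ?mulr_ge0 ?invr_ge0 ?cw_pmf_ge0//; [exact: ltW..| |].
    rewrite /q ler_wpM2l ?invr_ge0// -[leRHS]mulr1 ler_wpM2l ?cw_pmf_ge0//.
    by rewrite ler_pdivrMr// mul1r lerDr ltW.
  by rewrite ler_wpM2r// glauber_drift_flip.
- by rewrite divr_gt0// mulr_gt0// ltr_pwDl.
Qed.

End glauber.

Theorem proposition1p3 (R : realType) (beta h : R) (n : nat)
    (beta_ge0 : 0 <= beta) (n_ge1 : (1 <= n)%N)
    (d : measure_display) (T : measurableType d) (P : probability T R)
    (sigma : {RV P >-> config n})
    (sigma_law : forall A : set (config n),
       distribution P sigma A = curie_weiss n beta h A)
    (t : R) (t_ge0 : 0 <= t) :
  let m (w : T) : R := magnetization (sigma w) in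
  (P [set w | (`|m w - tanh (beta * m w + beta * h)|
                 >= beta / n%:R + t / Num.sqrt n%:R)%R]
     <= (2 * expR (- (t ^+ 2 / (4 * (1 + beta)))))%:E)%E.
Proof.
cbv zeta.
pose D (s : config n) : bool :=
  beta / n%:R + t / Num.sqrt n%:R <=
  `|magnetization s - tanh (beta * magnetization s + beta * h)|.
have -> : P [set w | D (sigma w)] =
    curie_weiss n beta h [set s | D s] by rewrite -sigma_law.
have -> : curie_weiss n beta h [set s | D s] =
    (\sum_(s | D s) cw_pmf beta h s)%:E.
  rewrite /curie_weiss fsbig_finite//= sumEFin; congr EFin.
  rewrite -[RHS]big_filter; apply: perm_big; apply: uniq_perm.
  - exact: finmap.fset_uniq.
  - by rewrite filter_uniq// index_enum_uniq.
  - move=> s; rewrite in_fset_set; last exact: finite_finset.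
    by rewrite mem_filter mem_index_enum andbT; apply/idP/idP; rewrite inE.
rewrite lee_fin.
have n_pos : 0 < n%:R :> R by rewrite ltr0n.
(* The tail bound is used at [u = t / sqrt n]; the factors of [n] cancel. *)
have -> : t ^+ 2 / (4 * (1 + beta)) =
    (t / Num.sqrt n%:R) ^+ 2 / (2 * (2 * (1 + beta) / n%:R)).
  rewrite expr_div_n sqr_sqrtr ?ler0n//; field.
  by rewrite !gt_eqF// ltr_pwDl.
apply: glauber_drift_tail => //; first by rewrite divr_ge0 ?sqrtr_ge0.
(* The shift [beta / n] in the threshold pays for replacing the cavity fields by the full field. *)
move=> s Ds; rewrite -(lerD2r (beta / n%:R)) addrC; apply: le_trans Ds _.
exact: magnetization_drift_dist.
Qed.
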